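(* In the common priority model, under the Cover policy (with students playing a symmetric Bayesian Nash equilibrium): (1) Ex-post, with a positive probability, at least $m-\ell$ schools' capacities are wasted and at least an equal number of students (equal to the wasted capacity) are unmatched. (2) Interim, each student believes that he has a positive probability of being unmatched. (3) Ex-ante, each student obtains an equal random assignment that is first-order stochastically dominated by the counterpart under the Reveal policy, namely the random assignment $\left(\frac{q_s}{n}\cdot s\right)_{s\in S}$ giving each school $s$ with probability $\frac{q_s}{n}$.
   Context: Common priority model. There are $n$ students $I=\{i_1,\dots,i_n\}$ and $m$ schools $S=\{s_1,\dots,s_m\}$. Each school $s$ has capacity $q_s\in\mathbb N$, and $\sum_{s\in S}q_s=n$. Each student $i$ has a utility vector $\mathbf v^i=(v^i_1,\dots,v^i_m)$, where $v^i_k\in[0,1]$ is his utility of attending $s_k$. Each $\mathbf v^i$ is drawn independently from a finite set $\mathcal V$ of vectors $(v_k)_{k=1}^m\in[0,1]^m$ with $v_1>v_2>\cdots>v_m$, with probability $f(\mathbf v^i)\in(0,1)$; so all students have the ordinal preference $s_1\succ s_2\succ\cdots\succ s_m$. Students know their own utilities but not the others', except for the distribution $f$; the number of students and the capacities are common knowledge. All students are in priority ties for all schools. Ties are broken at all schools by a single lottery, a one-to-one mapping $\pi:I\to\{1,\dots,n\}$ drawn uniformly at random; $\pi(i)<\pi(j)$ means $i$ is ranked above $j$. A matching assigns each student to a school or leaves him unmatched (denoted $\emptyset$), respecting capacities. Each student submits a rank-order list (ROL) of at most $\ell$ schools, where $\ell<m$; $\mathcal L^\ell$ is the set of all such lists.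 The mechanism is $\mathrm{DA}^\ell$, student-proposing deferred acceptance with these constrained lists: in each step every unassigned student applies to the best school on his ROL that has not rejected him, and each school tentatively admits, up to capacity, the highest-ranked applicants among those tentatively admitted in the previous step and the new applicants. Cover policy: students are uninformed about the lottery outcome when submitting ROLs. A (mixed) strategy is a mapping $\sigma:\mathcal V\to\Delta(\mathcal L^\ell)$, where $\Delta(\mathcal L^\ell)$ is the set of probability distributions on $\mathcal L^\ell$; in a symmetric Bayesian Nash equilibrium $\sigma^*$, each student $i$ plays $\sigma^*(\mathbf v^i)$, so students with identical utilities play the same strategy. Reveal policy: each student $i$ is informed of his own lottery number $\pi(i)$ before submitting his ROL. Ex-ante refers to the timing before utilities are realized; interim, for an individual student, to the timing when he knows only his own utilities (not the others' utilities nor the lottery outcome); ex-post to the timing after the lottery has been drawn and ROLs have been submitted. First-order stochastic dominance is with respect to $s_1\succ s_2\succ\cdots\succ s_m$ with $\emptyset$ last: a distribution $p$ on $S\cup\{\emptyset\}$ is dominated by $p'$ if $\sum_{y=1}^k p(s_y)\le\sum_{y=1}^k p'(s_y)$ for every $k=1,\dots,m$. *)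

(* Defs.v *)
From mathcomp Require Import all_boot all_order all_algebra all_fingroup finmap.

Set Implicit Arguments.
Unset Strict Implicit.
Unset Printing Implicit Defensive.

Import Order.TTheory GRing.Theory Num.Theory.
Local Open Scope ring_scope.

Record fdist (R : realFieldType) (T : finType) := FDist {
  fdist_fun :> T -> R;
  fdist_ge0 : forall x, 0 <= fdist_fun x;
  fdist_sum1 : \sum_(x : T) fdist_fun x = 1
}.

(* Rank-order lists: repetition-free, at most l schools, best school first. *)
Definition rol (m l : nat) := {L : l.-bseq 'I_m | uniq L}.

Definition schools_of m l (L : rol m l) : seq 'I_m := val L.

Section DeferredAcceptance.

Variables (n m l : nat) (q : 'I_m -> nat).
Variables (lists : {ffun 'I_n -> rol m l}) (lottery : 'S_n).

(* The state of the algorithm is the set of pairs (i, s) such that s has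
   rejected i.  The best school that has not yet rejected i is the one that
   tentatively holds i, or the one i newly applies to when i is not held. *)
Definition applies_to (rejected : {set 'I_n * 'I_m}) (i : 'I_n)
    : option 'I_m :=
  ohead [seq s <- schools_of (lists i) | (i, s) \notin rejected].

(* Lottery numbers are counted from 0, and smaller ones are ranked higher. *)
Definition ahead (rejected : {set 'I_n * 'I_m}) (i : 'I_n) (s : 'I_m)
    : {set 'I_n} :=
  [set j | (applies_to rejected j == Some s) && (lottery j < lottery i)%N].

Definition da_step (rejected : {set 'I_n * 'I_m}) : {set 'I_n * 'I_m} :=
  rejected :|: [set x | (applies_to rejected x.1 == Some x.2)
                        && (q x.2 <= #|ahead rejected x.1 x.2|)%N].

(* Each non-final step adds a rejection, so n * m steps reach termination;
   None means unmatched. *)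
Definition da (i : 'I_n) : option 'I_m :=
  applies_to (iter (n * m) da_step set0) i.

End DeferredAcceptance.

Section Game.

Variables (R : realFieldType) (n m l : nat) (q : 'I_m -> nat).
(* u0 is the utility of being unmatched. *)
Variables (V : {fset 'rV[R]_m}) (f : fdist R V) (u0 : R).

(* A play: realized utilities, submitted lists, lottery outcome. *)
Definition play : Type :=
  ({ffun 'I_n -> V} * {ffun 'I_n -> rol m l} * 'S_n)%type.

Definition types (w : play) : {ffun 'I_n -> V} := w.1.1.
Definition lists (w : play) : {ffun 'I_n -> rol m l} := w.1.2.
Definition lottery (w : play) : 'S_n := w.2.

Definition outcome (w : play) (i : 'I_n) : option 'I_m :=
  da q (lists w) (lottery w) i.

Definition payoff (i : 'I_n) (w : play) : R :=
  if outcome w i is Some s then val (types w i) 0 s else u0.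

(* b i v k is the mixed list of student i given utilities v and own lottery
   number k.  This covers both information policies: under the Cover policy
   behaviour may not depend on k. *)
Definition behaviour := 'I_n -> V -> 'I_n -> fdist R (rol m l).

Definition uninformed (sigma : 'I_n -> V -> fdist R (rol m l)) : behaviour :=
  fun i v _ => sigma i v.

Definition law (b : behaviour) (w : play) : R :=
  (\prod_i f (types w i))
  * (\prod_i b i (types w i) (lottery w i) (lists w i))
  / (n`!)%:R.

Definition Pr (b : behaviour) (E : pred play) : R := \sum_(w | E w) law b w.

Definition cond_Pr (b : behaviour) (A E : pred play) : R :=
  Pr b (predI A E) / Pr b A.

Definition cond_Ex (b : behaviour) (A : pred play) (X : play -> R) : R :=
  (\sum_(w | A w) law b w * X w) / Pr b A.

(* Student i plays the mixed list p instead of b i. *)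
Definition deviate (b : behaviour) (i : 'I_n) (p : fdist R (rol m l))
    : behaviour :=
  fun j v k => if j == i then p else b j v k.

Definition knows_type (i : 'I_n) (v : V) : pred play :=
  fun w => types w i == v.

Definition knows_type_number (i : 'I_n) (v : V) (k : 'I_n) : pred play :=
  fun w => (types w i == v) && (lottery w i == k).

(* Bayesian Nash equilibrium: optimality given each student's information. *)
Definition cover_BNE (sigma : 'I_n -> V -> fdist R (rol m l)) : Prop :=
  forall (i : 'I_n) (v : V) (p : fdist R (rol m l)),
    cond_Ex (deviate (uninformed sigma) i p) (knows_type i v) (payoff i)
    <= cond_Ex (uninformed sigma) (knows_type i v) (payoff i).

Definition symmetric_cover_BNE (sigma : V -> fdist R (rol m l)) : Prop :=
  cover_BNE (fun _ => sigma).

Definition reveal_BNE (tau : behaviour) : Prop :=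
  forall (i : 'I_n) (v : V) (k : 'I_n) (p : fdist R (rol m l)),
    cond_Ex (deviate tau i p) (knows_type_number i v k) (payoff i)
    <= cond_Ex tau (knows_type_number i v k) (payoff i).

Definition assigned (w : play) (x : option 'I_m) : {set 'I_n} :=
  [set i | outcome w i == x].

Definition wasted_schools (w : play) : {set 'I_m} :=
  [set s | assigned w (Some s) == set0].

(* All unfilled seats, including those of partially filled schools. *)
Definition wasted_capacity (w : play) : nat :=
  \sum_(s : 'I_m) (q s - #|assigned w (Some s)|)%N.

Definition random_assignment (b : behaviour) (i : 'I_n) (x : option 'I_m)
    : R :=
  Pr b (fun w => outcome w i == x).

Definition proportional_assignment (x : option 'I_m) : R :=
  if x is Some s then (q s)%:R / n%:R else 0.

(* p is first-order stochastically dominated by p'; lower school indices are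
   better and None is last. *)
Definition fosd_by (p p' : option 'I_m -> R) : Prop :=
  forall k : 'I_m,
    \sum_(s : 'I_m | (s <= k)%N) p (Some s)
    <= \sum_(s : 'I_m | (s <= k)%N) p' (Some s).

End Game.

(* Main.v *)
Require Import Defs.
From mathcomp Require Import all_boot all_order all_algebra all_fingroup finmap.
Import Order.TTheory GRing.Theory Num.Theory.
Local Open Scope ring_scope.

(* Under a single lottery, deferred acceptance is serial dictatorship: every
   student gets the best school on his list that is not yet filled by students
   with better lottery numbers.  Hence outcomes respect capacities, commute
   with relabelling students, and do not depend on the lists of students with
   worse numbers.

   For any list that type v submits with positive probability, all students
   have type v and submit that list with positive probability; then the m - l
   unlisted schools stay empty, so somebody is unmatched, and by relabelling it
   can be any given student.  By symmetry n times the probability that a student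
   gets s is the expected number of students at s, hence at most q s.

   Under the Reveal policy let slot k be the school reached by number k when
   the schools fill up in the order of preference.  If the numbers below k get
   their slots, then number k can get nothing better than slot k and gets it by
   listing it alone; so listing one's slot is an equilibrium and, by induction
   on k, when being unmatched is strictly worst every equilibrium gives each
   number its slot almost surely. *)

Set Implicit Arguments.
Unset Strict Implicit.
Unset Printing Implicit Defensive.

(** * Iterated set operators, ranks in finite sets, heads of filtered lists *)

Lemma iter_fixed (T : finType) (F : {set T} -> {set T}) :
  (forall X : {set T}, X \subset F X) ->
  F (iter #|T| F set0) = iter #|T| F set0.
Proof.
(* Until it becomes fixed, the iterate gains at least one element per step; [#|T|] gains exhaust
   [T]. *)
move=> subF; have fixed_or_large k :
    F (iter k F set0) = iter k F set0 \/ (k <= #|iter k F set0|)%N.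
  elim: k => [|k [fixk|lek]]; first by right.
    by left; rewrite iterS fixk.
  rewrite iterS; case: (eqVneq (F (iter k F set0)) (iter k F set0)) => [fixk|neq].
    by left; rewrite fixk.
  right; apply: leq_ltn_trans lek _; apply: proper_card.
  by rewrite properEneq eq_sym neq; apply: subF.
case: (fixed_or_large #|T|) => // large; apply/esym/eqP; rewrite eqEcard.
by apply/andP; split; [apply: subF | apply: leq_trans (max_card _) large].
Qed.

(** If the low-rank set had fewer than [c] members, a member of [A] outside it of minimal rank would
    have only low-rank members strictly below it, hence fewer than [c], and would belong to it. *)
Lemma card_low_rank (T : finType) (r : T -> nat) (A : {set T}) (c : nat) :
  (c <= #|A|)%N ->
  (c <= #|[set j in A | #|[set k in A | r k < r j]| < c]|)%N.
Proof.
move=> leA; rewrite leqNgt; apply/negP; set B := [set j in A | _] => ltB.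
have subB : B \subset A by apply/subsetP=> j; rewrite inE => /andP[].
have: (0 < #|A :\: B|)%N by rewrite cardsD (setIidPr subB) subn_gt0 (leq_trans ltB).
case/card_gt0P=> j0 Dj0.
case: (arg_minnP r Dj0) => j /setDP[Aj NBj] minj.
case/negP: NBj; rewrite inE Aj /=; apply: leq_ltn_trans ltB.
apply/subset_leq_card/subsetP=> k; rewrite inE => /andP[Ak]; apply: contraLR.
by move=> NBk; rewrite -leqNgt; apply: minj; apply/setDP.
Qed.

(** Everything before the head fails [p], hence also [p']. This keeps a student at the same school
    while rejections accumulate elsewhere. *)
Lemma ohead_filter_sub (T : eqType) (p p' : pred T) (s : seq T) (x : T) :
  ohead (filter p s) = Some x -> {in s, forall y, p' y -> p y} -> p' x ->
  ohead (filter p' s) = Some x.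
Proof.
move=> + + p'x; elim: s => //= y s IHs.
case: ifP => [_ [->] _|py hd sub]; first by rewrite p'x.
case: ifP => [p'y|_]; first by rewrite sub ?mem_head in py.
by apply: IHs => // z zs; apply: sub; rewrite inE zs orbT.
Qed.

Lemma ohead_filterP (T : eqType) (p : pred T) (s : seq T) (x : T) :
  ohead (filter p s) = Some x -> x \in s /\ p x.
Proof.
move=> hd; suff: x \in filter p s by rewrite mem_filter => /andP[].
by case: (filter p s) hd => // y t [->]; apply: mem_head.
Qed.

Lemma ohead_filter_all (T : eqType) (p p' : pred T) (s : seq T) :
  {in s, forall y, p' y -> p y} ->
  (forall x, ohead (filter p s) = Some x -> p' x) ->
  ohead (filter p s) = ohead (filter p' s).
Proof.
move=> sub hdp; case hd: (ohead (filter p s)) => [x|].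
  by rewrite (ohead_filter_sub hd sub) // hdp.
case hd': (ohead (filter p' s)) => [x|//].
have [xs p'x] := ohead_filterP hd'; have px := sub x xs p'x.
suff: x \in filter p s by case: (filter p s) hd.
by rewrite mem_filter px.
Qed.

(** * Single-lottery deferred acceptance as serial dictatorship *)

Section SerialDictatorship.

Variables (n m l : nat) (q : 'I_m -> nat).
Implicit Types (lists : {ffun 'I_n -> rol m l}) (lottery : 'S_n).

Definition admitted_before lists lottery (i : 'I_n) (s : 'I_m) : {set 'I_n} :=
  [set j | (da q lists lottery j == Some s) && (lottery j < lottery i)%N].

Lemma da_step_sub lists lottery (X : {set 'I_n * 'I_m}) :
  X \subset da_step q lists lottery X.
Proof. exact: subsetUl. Qed.

(* Among the applicants of s ahead of i, the best q s are never rejected, so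
   a rejected student keeps at least q s better applicants ever after. *)
Lemma rejected_ahead lists lottery k i s :
  let X := iter k (da_step q lists lottery) set0 in
  (i, s) \in X -> (q s <= #|ahead lists lottery X i s|)%N.
Proof.
elim: k i s => [|k IHk] i s; first by rewrite /= inE.
rewrite /=; set X := iter k _ _ => iX'.
set A := ahead lists lottery X i s.
have leA : (q s <= #|A|)%N.
  by move: iX'; rewrite !inE => /orP[/IHk|/andP[]].
apply: leq_trans (card_low_rank (fun j => lottery j) leA) _.
apply/subset_leq_card/subsetP=> j; rewrite !inE => /andP[/andP[/eqP appj ltji] ltq].
rewrite ltji andbT; apply/eqP/(ohead_filter_sub appj) => [t _|].
  by apply: contra => /(subsetP (da_step_sub lists lottery X)).
have [_ /negPf NX] := ohead_filterP appj.
rewrite !inE NX /= appj eqxx /= -ltnNge.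
apply: leq_ltn_trans ltq; apply/subset_leq_card/subsetP=> t.
by rewrite !inE => /andP[-> ltj]; rewrite ltj (ltn_trans ltj).
Qed.

Lemma da_fixed lists lottery :
  let X := iter (n * m) (da_step q lists lottery) set0 in
  da_step q lists lottery X = X.
Proof.
rewrite /=; have := iter_fixed (da_step_sub lists lottery).
by rewrite card_prod !card_ord.
Qed.

(** A school that rejected [i] ends with [q s] better applicants by [rejected_ahead], so it is full
    before [i]. Conversely, were the final choice of [i] full before him, one more step would reject
    him, against [da_fixed]. *)
Lemma da_serial lists lottery i :
  da q lists lottery i =
  ohead [seq s <- schools_of (lists i)
        | (#|admitted_before lists lottery i s| < q s)%N].
Proof.
apply: ohead_filter_all => [s _ |s hd].
  by rewrite ltnNge; apply/contra => /rejected_ahead.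
rewrite ltnNge; apply/negP => full.
have [_ /negP] := ohead_filterP hd; apply; rewrite -da_fixed !inE /=.
by apply/orP; right; rewrite /applies_to hd eqxx.
Qed.

Lemma da_listed lists lottery i s :
  da q lists lottery i = Some s ->
  s \in schools_of (lists i) /\ (#|admitted_before lists lottery i s| < q s)%N.
Proof. by rewrite da_serial => /ohead_filterP. Qed.

Lemma da_capacity lists lottery s :
  (#|[set i | da q lists lottery i == Some s]| <= q s)%N.
Proof.
set A := [set i | _]; have [->|] := eqVneq A set0; first by rewrite cards0.
case/set0Pn=> i0 Ai0.
case: (arg_maxnP (fun i => lottery i : nat) Ai0) => i Ai maxi.
have {}Ai : i \in A by []; rewrite (cardsD1 i) Ai; move: Ai; rewrite inE => /eqP/da_listed[_].
apply: leq_ltn_trans; apply/subset_leq_card/subsetP=> j; rewrite !inE.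
case/andP=> neji daj; have Aj : j \in A by rewrite inE.
rewrite daj /= ltn_neqAle; apply/andP; split; last exact: maxi Aj.
by apply: contra neji => /eqP/val_inj/perm_inj->.
Qed.

(** Induction on the lottery number: by [da_serial] an outcome depends only on the student's own
    list and on the outcomes of better numbers. *)
Lemma da_ahead_only lists lists' lottery i :
  (forall j, (lottery j <= lottery i)%N -> lists j = lists' j) ->
  da q lists lottery i = da q lists' lottery i.
Proof.
have [c] := ubnP (lottery i); elim: c i => // c IHc i; rewrite ltnS => lec eql.
rewrite !da_serial eql //; congr ohead; apply: eq_filter => s.
congr (_ < _)%N; congr #|pred_of_set _|; apply/setP=> j; rewrite !inE.
case: ltnP => [ltji|]; rewrite ?andbF // !andbT IHc //.
  exact: leq_trans ltji lec.
by move=> k lekj; apply: eql; apply: leq_trans lekj (ltnW ltji).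
Qed.

Lemma da_equivariant lists lottery (g : 'S_n) i :
  da q [ffun j => lists (g j)] (g * lottery)%g i = da q lists lottery (g i).
Proof.
have [c] := ubnP ((g * lottery)%g i); elim: c i => // c IHc i; rewrite ltnS => lec.
rewrite !da_serial ffunE; congr ohead; apply: eq_filter => s; congr (_ < _)%N.
rewrite -[RHS](card_preimset _ (@perm_inj _ g)); congr #|pred_of_set _|.
apply/setP=> j; rewrite !inE !permM.
case: ltnP => [ltji|]; rewrite ?andbF // !andbT IHc //.
by rewrite !permM in lec *; apply: leq_trans ltji lec.
Qed.

End SerialDictatorship.

(** * Slots: schools filled in the order of preference *)

Section Slots.

Variables (n m : nat) (q : 'I_m -> nat).

Lemma slot_exists : (\sum_(s : 'I_m) q s)%N = n ->
  exists slot : 'I_n -> 'I_m,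
    (forall j k : 'I_n, (j <= k)%N -> (slot j <= slot k)%N)
    /\ forall s, #|[set k | slot k == s]| = q s.
Proof.
(* [X] contains each school [s] exactly [q s] times, so it has length [n]; once sorted, its entry at
   [k] is the slot of number [k]. *)
move=> sum_q; set X := flatten [seq nseq (q s) s | s <- enum 'I_m].
pose Y := sort (fun s t : 'I_m => s <= t)%N X.
have sizeY : size Y == n.
  rewrite size_sort size_flatten /shape -map_comp -sum_q -big_enum /=.
  rewrite sumnE big_map; apply/eqP/eq_bigr => s _.
  exact: size_nseq.
have sortedY : sorted (fun s t : 'I_m => s <= t)%N Y.
  by apply: sort_sorted => s t; apply: leq_total.
exists (tnth (Tuple sizeY)); split=> [j k lejk|s].
  have x0 := tnth (Tuple sizeY) j; rewrite !(tnth_nth x0) /=.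
  apply: (sorted_leq_nth (leT := fun s t : 'I_m => s <= t)%N) => //.
  - by move=> s t u; apply: leq_trans.
  - by rewrite inE /= (eqP sizeY) ltn_ord.
  - by rewrite inE /= (eqP sizeY) ltn_ord.
rewrite -sum1dep_card -(big_tuple _ _ (Tuple sizeY) (pred1 s) (fun _ => 1%N)).
rewrite sum1_count count_sort count_flatten -map_comp sumnE big_map big_enum /=.
rewrite (bigD1 s) //= count_nseq /= eqxx mul1n big1 ?addn0 // => t nets.
by rewrite count_nseq /= (negPf nets).
Qed.

Variables (slot : 'I_n -> 'I_m).
Hypothesis slot_homo : forall j k : 'I_n, (j <= k)%N -> (slot j <= slot k)%N.
Hypothesis slot_card : forall s, #|[set k | slot k == s]| = q s.

(** If [s] is better than the slot of [i], all [q s] numbers with slot [s] precede [i] by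
    monotonicity and hold their seats, so [s] is already full. *)
Lemma slot_upper l (lists : {ffun 'I_n -> rol m l}) (lottery : 'S_n) i s :
  (forall j, (lottery j < lottery i)%N ->
     da q lists lottery j = Some (slot (lottery j))) ->
  da q lists lottery i = Some s -> (slot (lottery i) <= s)%N.
Proof.
move=> before /da_listed[_]; apply: contraLR; rewrite -!ltnNge ltnS => lts.
rewrite -slot_card -[leqLHS](card_preimset _ (@perm_inj _ lottery)).
apply/subset_leq_card/subsetP=> j; rewrite !inE => /eqP slotj.
have ltji : (lottery j < lottery i)%N.
  by rewrite ltnNge; apply: contraL lts => /slot_homo; rewrite slotj -leqNgt.
by rewrite ltji before // slotj eqxx.
Qed.

(** Those ahead of [i] at the school of his slot all have that school as slot; [i] has it too but is
    not ahead of himself, so a seat remains. *)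
Lemma slot_attained l (lists : {ffun 'I_n -> rol m l}) (lottery : 'S_n) i :
  (forall j, (lottery j < lottery i)%N ->
     da q lists lottery j = Some (slot (lottery j))) ->
  schools_of (lists i) = [:: slot (lottery i)] ->
  da q lists lottery i = Some (slot (lottery i)).
Proof.
move=> before listi; rewrite da_serial listi /=; case: ifP => // /negP[].
set s := slot _; rewrite -slot_card -[ltnRHS](card_preimset _ (@perm_inj _ lottery)).
apply: proper_card; apply/properP; split; last first.
  by exists i; rewrite !inE ?ltnn ?andbF.
apply/subsetP=> j; rewrite !inE => /andP[/eqP + /before eqj].
by rewrite eqj => -[->].
Qed.

End Slots.

(** * Finite distributions and the law of plays *)

Lemma fdist_support (R : realFieldType) (T : finType) (p : fdist R T) : exists x, p x != 0.
Proof.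
apply/existsP; apply: contraT; rewrite negb_exists => /forallP p0.
move: (fdist_sum1 p) => /eqP; rewrite big1 1?eq_sym ?oner_eq0 // => x _.
exact/eqP/negPn/p0.
Qed.

Definition point_mass (R : realFieldType) (T : finType) (x : T) : fdist R T.
Proof.
exists (fun y => (y == x)%:R) => [y|]; first exact: ler0n.
by rewrite (bigD1 x) //= eqxx big1 ?addr0 // => y /negPf->.
Defined.

Lemma point_mass_neq0 (R : realFieldType) (T : finType) (x y : T) :
  (point_mass R x y != 0) = (y == x).
Proof. by rewrite /=; case: (y == x); rewrite ?oner_eq0 ?eqxx. Qed.

Section Probability.

Variables (R : realFieldType) (n m l : nat) (V : {fset 'rV[R]_m}).
Variables (f : fdist R V).
Hypothesis f_gt0 : forall v : V, 0 < f v.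
Implicit Types (b : behaviour n l V) (w : play n l V).

Lemma law_ge0 b w : 0 <= law f b w.
Proof.
rewrite /law !mulr_ge0 ?invr_ge0 ?ler0n //; apply: prodr_ge0 => i _;
  exact: fdist_ge0.
Qed.

Lemma law_neq0P b w :
  reflect (forall i, b i (types w i) (lottery w i) (lists w i) != 0)
          (law f b w != 0).
Proof.
rewrite /law !mulf_eq0 !negb_or invr_eq0 pnatr_eq0 -lt0n fact_gt0 andbT.
have -> /= : \prod_i f (types w i) != 0.
  by apply/prodf_neq0 => i _; rewrite gt_eqF.
by apply: (iffP (prodf_neq0 _ _)) => [H i|H i _]; apply: H.
Qed.

Lemma play_exists b (t : {ffun 'I_n -> V}) (lot : 'S_n) :
  exists L, law f b (t, L, lot) != 0.
Proof.
have [L HL] := fin_all_exists (fun i => fdist_support (b i (t i) (lot i))).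
by exists (finfun L); apply/law_neq0P => i; rewrite /lists /= ffunE; apply: HL.
Qed.

Lemma Pr_gt0 b (E : pred (play n l V)) w :
  E w -> law f b w != 0 -> 0 < Pr f b E.
Proof.
move=> Ew lw; rewrite /Pr (bigD1 w) //= ltr_pwDl ?lt0r ?lw ?law_ge0 //.
by apply: sumr_ge0 => w' _; apply: law_ge0.
Qed.

Lemma eq_Pr b (E E' : pred (play n l V)) :
  (forall w, law f b w != 0 -> E w = E' w) -> Pr f b E = Pr f b E'.
Proof.
move=> eqE; rewrite /Pr big_mkcond [RHS]big_mkcond; apply: eq_bigr => w _.
by have [->|/eqE->] := eqVneq (law f b w) 0; first by rewrite !if_same.
Qed.

(** The lottery stays uniform even when behaviour reacts to lottery numbers: for a fixed lottery,
    first the lists and then the types sum out to one. *)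
Lemma Pr_lottery b (P : pred 'S_n) :
  Pr f b (fun w => P (lottery w)) = #|P|%:R / (n`!)%:R.
Proof.
transitivity (\sum_(lot | P lot) \sum_t \sum_L law f b (t, L, lot)).
  rewrite /Pr (eq_bigr (fun lot => \sum_tl law f b (tl, lot))); last first.
    by move=> lot _; rewrite pair_bigA; apply: eq_bigr => -[].
  by rewrite exchange_big pair_big /=; apply: eq_big => [[]|[]].
rewrite -sum1_card natr_sum mulr_suml; apply: eq_bigr => lot _.
transitivity (\sum_(t : {ffun 'I_n -> V}) (\prod_i f (t i)) / (n`!)%:R :> R).
  apply: eq_bigr => t _; rewrite /law /types /lists /lottery /=.
  rewrite -mulr_suml -mulr_sumr -(bigA_distr_bigA (fun i => b i (t i) (lot i))).
  by rewrite [X in _ * X / _]big1 ?mulr1 // => i _; apply: fdist_sum1.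
rewrite -mulr_suml -(bigA_distr_bigA (fun _ v => f v)) big1 // => i _.
exact: fdist_sum1.
Qed.

Lemma cond_Ex_le b (A : pred (play n l V)) X a :
  0 < Pr f b A -> (forall w, A w -> law f b w != 0 -> X w <= a) ->
  cond_Ex f b A X <= a.
Proof.
move=> PrA leX; rewrite /cond_Ex ler_pdivrMr // /Pr mulr_sumr.
apply: ler_sum => w Aw; rewrite [a * _]mulrC.
have [->|lw] := eqVneq (law f b w) 0; first by rewrite !mul0r.
by rewrite ler_wpM2l ?law_ge0 ?leX.
Qed.

Lemma cond_Ex_const b (A : pred (play n l V)) X a :
  0 < Pr f b A -> (forall w, A w -> law f b w != 0 -> X w = a) ->
  cond_Ex f b A X = a.
Proof.
move=> PrA eqX; rewrite /cond_Ex (eq_bigr (fun w => law f b w * a)).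
  by rewrite -mulr_suml -/(Pr f b A) mulrAC divff ?mul1r ?gt_eqF.
move=> w Aw; have [->|lw] := eqVneq (law f b w) 0; first by rewrite !mul0r.
by rewrite eqX.
Qed.

(** The weighted differences between [X] and [a] are all nonpositive while their sum is nonnegative,
    so each vanishes. This turns an equilibrium inequality into a fact about every play of positive
    probability. *)
Lemma cond_Ex_ge_eq b (A : pred (play n l V)) X a :
  0 < Pr f b A -> (forall w, A w -> law f b w != 0 -> X w <= a) ->
  a <= cond_Ex f b A X -> forall w, A w -> law f b w != 0 -> X w = a.
Proof.
move=> PrA leX; rewrite /cond_Ex ler_pdivlMr // /Pr mulr_sumr -subr_ge0 -sumrB.
move=> ge0 w Aw lw; have term_le0 w' : A w' ->
    law f b w' * X w' - a * law f b w' <= 0.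
  move=> Aw'; rewrite [a * _]mulrC -mulrBr.
  have [->|lw'] := eqVneq (law f b w') 0; first by rewrite mul0r.
  by rewrite mulr_ge0_le0 ?law_ge0 ?subr_le0 ?leX.
apply/eqP; rewrite eq_le leX //= -subr_ge0 -(pmulr_rge0 _ (_ : 0 < law f b w)).
  rewrite mulrBr [_ * a]mulrC; apply: le_trans ge0 _; rewrite (bigD1 w) //= gerDl.
  by apply: sumr_le0 => w' /andP[]; auto.
by rewrite lt0r lw law_ge0.
Qed.

(** Replacing the list of [i] by one that [b] allows gives a possible play under [b], so facts about
    students ahead of [i] carry over to deviations. *)
Lemma law_deviate b i p w :
  law f (deviate b i p) w != 0 ->
  exists L, law f b (types w, L, lottery w) != 0
            /\ forall j, j != i -> L j = lists w j.
Proof.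
move/law_neq0P => lw.
have [Li bLi] := fdist_support (b i (types w i) (lottery w i)).
exists [ffun j => if j == i then Li else lists w j]; split; last first.
  by move=> j /negPf neji; rewrite ffunE neji.
apply/law_neq0P => j; rewrite /types /lottery /lists /= ffunE.
by have := lw j; rewrite /deviate; case: (eqVneq j i) => [->|] //.
Qed.

(** Composing with the transposition of [i] and [k] shows that [lot i] takes every value equally
    often. *)
Lemma card_perm_at (i : 'I_n) (P : pred 'I_n) :
  (#|[pred lot : 'S_n | P (lot i)]| * n = #|P| * n`!)%N.
Proof.
pose C k := #|[pred lot : 'S_n | lot i == k]|.
have C_const k : C k = C i.
  rewrite /C -!sum1_card (reindex_inj (mulIg (tperm i k))) /=.
  apply: eq_bigl => lot; rewrite !inE permM.
  by rewrite -{2}(tpermL i k) (inj_eq perm_inj).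
have card_at (Q : pred 'I_n) : #|[pred lot : 'S_n | Q (lot i)]| = (#|Q| * C i)%N.
  rewrite -sum1_card (partition_big (fun lot : 'S_n => lot i) Q) //=.
  rewrite -sum_nat_const; apply: eq_bigr => k Qk; rewrite -(C_const k).
  rewrite /C -sum1_card; apply: eq_bigl => lot; rewrite !inE.
  by case: eqP => [->|]; rewrite ?andbF // andbT.
have := card_at xpredT; rewrite card_at (_ : #|[pred _ | _]| = n`!) => [->|].
  by rewrite cardT size_enum_ord [(n * _)%N]mulnC mulnA.
by rewrite -(card_Sn n); apply: eq_card.
Qed.

(** * Wasted seats and unmatched students *)

Variable q : 'I_m -> nat.
Hypothesis sum_q : (\sum_(s : 'I_m) q s)%N = n.

(** Capacities add up to [n], so both sides are [n] minus the number of matched students;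
    [da_capacity] ensures that no subtraction truncates. *)
Lemma wasted_capacityE w : wasted_capacity q w = #|assigned q w None|.
Proof.
have total : (\sum_(s : 'I_m) #|assigned q w (Some s)| + #|assigned q w None|)%N
             = n.
  rewrite -[RHS]card_ord -[RHS]sum1_card.
  rewrite [RHS](partition_big (fun i => outcome q w i) xpredT) //=.
  rewrite [RHS](bigD1 None) //= sum1dep_card [RHS]addnC; congr addn.
  rewrite [RHS](reindex_omap Some id) => [|[]//]; rewrite /=.
  by apply: eq_big => [s|s _]; rewrite ?eqxx ?sum1dep_card.
rewrite -[RHS](addKn (\sum_(s : 'I_m) #|assigned q w (Some s)|)%N) total.
rewrite -[X in (X - _)%N]sum_q -sumnB // => s _; exact: da_capacity.
Qed.

(** Only listed schools can admit anyone, and the common list names at most [l] of them. *)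
Lemma wasted_monomorphic w (L : rol m l) :
  (forall i, lists w i = L) -> (m - l <= #|wasted_schools q w|)%N.
Proof.
move=> listL; pose listed := [set s in schools_of L].
have le_l : (#|listed| <= l)%N.
  rewrite cardsE; apply: leq_trans (card_size _) _; exact: size_bseq.
apply: leq_trans (leq_sub2l m le_l) _.
rewrite leq_subLR -{1}(card_ord m) -(cardsC listed) leq_add2l.
apply/subset_leq_card/subsetP=> s; rewrite !inE => NLs.
apply/set0Pn => -[i]; rewrite inE => /eqP/da_listed[+ _].
by rewrite listL (negPf NLs).
Qed.

Lemma unmatched_exists w : (forall s, (0 < q s)%N) ->
  (0 < #|wasted_schools q w|)%N -> exists i, outcome q w i = None.
Proof.
move=> q_gt0 /card_gt0P[s]; rewrite inE => /eqP wasted_s.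
suff /card_gt0P[i] : (0 < #|assigned q w None|)%N.
  by rewrite inE => /eqP; exists i.
by rewrite -wasted_capacityE /wasted_capacity (bigD1 s) //= wasted_s cards0 subn0
  addn_gt0 q_gt0.
Qed.

(** * Symmetry between students under a common strategy *)

Section Symmetry.

Variable sigma : V -> fdist R (rol m l).
Let b : behaviour n l V := uninformed (fun _ => sigma).

(** Student [i] takes over the type, list and number of [g i]; a product of permutations applies its
    left factor first. *)
Definition relabel (g : 'S_n) w : play n l V :=
  ([ffun i => types w (g i)], [ffun i => lists w (g i)], (g * lottery w)%g).

Lemma relabel_inj g : injective (relabel g).
Proof.
case=> [[t L] lot] [[t' L'] lot'] [/ffunP eqt /ffunP eqL /mulgI ->].
congr (_, _, _); apply/ffunP => i; rewrite -(permKV g i).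
  by have := eqt (g^-1 i)%g; rewrite !ffunE.
by have := eqL (g^-1 i)%g; rewrite !ffunE.
Qed.

Lemma outcome_relabel g w i : outcome q (relabel g w) i = outcome q w (g i).
Proof. exact: da_equivariant. Qed.

Lemma law_relabel g w : law f b (relabel g w) = law f b w.
Proof.
rewrite /law /b /uninformed; congr (_ * _ / _).
  by rewrite [RHS](reindex_inj (@perm_inj _ g)); apply: eq_bigr => i _; rewrite ffunE.
rewrite [RHS](reindex_inj (@perm_inj _ g)); apply: eq_bigr => i _.
by rewrite /types /lists /= !ffunE.
Qed.

Lemma random_assignment_symmetric i j x :
  random_assignment q f b i x = random_assignment q f b j x.
Proof.
rewrite /random_assignment /Pr (reindex_inj (@relabel_inj (tperm i j))) /=.
apply: eq_big => [w|w _]; last exact: law_relabel.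
by rewrite outcome_relabel tpermL.
Qed.

Lemma random_assignment_le i s :
  random_assignment q f b i (Some s) <= (q s)%:R / n%:R.
Proof.
have n_gt0 : (0 < n)%N := leq_ltn_trans (leq0n i) (ltn_ord i).
rewrite ler_pdivlMr ?ltr0n // mulr_natr -[X in _ *+ X]card_ord -sumr_const.
rewrite (eq_bigr (fun j => random_assignment q f b j (Some s))); last first.
  by move=> j _; apply: random_assignment_symmetric.
rewrite /random_assignment /Pr; under eq_bigr do rewrite big_mkcond.
rewrite exchange_big /=.
(* The total mass is read off from [Pr_lottery] at the sure event. *)
have law1 : \sum_w law f b w = 1.
  have := Pr_lottery b xpredT; rewrite /Pr /= => ->.
  by rewrite -(card_Sn n) (eq_card (_ : _ =i 'S_n)) // divff // card_Sn pnatr_eq0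
    -lt0n fact_gt0.
have -> : (q s)%:R = (\sum_w law f b w) * (q s)%:R by rewrite law1 mul1r.
rewrite mulr_suml; apply: ler_sum => w _.
rewrite -big_mkcond sumr_const -[leLHS]mulr_natr ler_wpM2l ?law_ge0 // ler_nat.
by rewrite -cardsE; apply: da_capacity.
Qed.

End Symmetry.

(** * Equilibria under the Reveal policy *)

Section Reveal.

Variable slot : 'I_n -> 'I_m.
Hypothesis slot_homo : forall j k : 'I_n, (j <= k)%N -> (slot j <= slot k)%N.
Hypothesis slot_card : forall s, #|[set k | slot k == s]| = q s.

Definition slotted w i := outcome q w i = Some (slot (lottery w i)).

(** The number of [i] is uniform, and [q s] of the [n] numbers have slot [s]. *)
Lemma random_assignment_slotted b i x :
  (forall w, law f b w != 0 -> slotted w i) ->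
  random_assignment q f b i x = proportional_assignment R n q x.
Proof.
move=> slw; rewrite /random_assignment.
rewrite (@eq_Pr _ _ (fun w => Some (slot (lottery w i)) == x)); last first.
  by move=> w /slw ->.
rewrite (Pr_lottery b (fun lot => Some (slot (lot i)) == x)).
case: x => [s|] /=; last by rewrite eq_card0 ?mul0r.
have n_gt0 : (0 < n)%N := leq_ltn_trans (leq0n i) (ltn_ord i).
apply/eqP; rewrite eqr_div ?pnatr_eq0 -?lt0n ?fact_gt0 // -!natrM eqr_nat.
rewrite -(slot_card s) cardsE; apply/eqP.
exact: (card_perm_at i (fun k => slot k == s)).
Qed.

Variable u0 : R.
Hypothesis u0_last : forall (v : V) (s : 'I_m), u0 <= val v 0 s.
Hypothesis V_decr :
  forall (v : V) (s t : 'I_m), (s < t)%N -> val v 0 t < val v 0 s.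
Hypothesis l_gt0 : (0 < l)%N.

Lemma payoff_le_slot w i :
  (forall j, (lottery w j < lottery w i)%N -> slotted w j) ->
  payoff q u0 i w <= val (types w i) 0 (slot (lottery w i)).
Proof.
move=> before; rewrite /payoff; case out: (outcome q w i) => [s|//].
have := slot_upper slot_homo slot_card before out; rewrite leq_eqVlt.
by case/orP=> [/eqP/val_inj->//|/(V_decr (types w i))/ltW].
Qed.

(** The strict bound on [u0] excludes being unmatched, and strictly decreasing utilities exclude
    schools worse than the slot. *)
Lemma payoff_slot_slotted w i :
  (forall (v : V) (s : 'I_m), u0 < val v 0 s) ->
  (forall j, (lottery w j < lottery w i)%N -> slotted w j) ->
  payoff q u0 i w = val (types w i) 0 (slot (lottery w i)) -> slotted w i.
Proof.
move=> u0_lt before; rewrite /payoff /slotted.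
case out: (outcome q w i) => [s|] val_eq; last first.
  by have := u0_lt (types w i) (slot (lottery w i)); rewrite val_eq ltxx.
have := slot_upper slot_homo slot_card before out; rewrite leq_eqVlt.
case/orP=> [/eqP/val_inj->//|/(V_decr (types w i))].
by rewrite val_eq ltxx.
Qed.

Lemma payoff_slotted w i :
  slotted w i -> payoff q u0 i w = val (types w i) 0 (slot (lottery w i)).
Proof. by rewrite /payoff => ->. Qed.

Lemma Pr_knows_type_number_gt0 b i v k :
  0 < Pr f b (knows_type_number i v k).
Proof.
have [L lL] := play_exists b [ffun=> v] (tperm i k).
by apply: Pr_gt0 lL; rewrite /knows_type_number /types /= ffunE tpermL !eqxx.
Qed.

Definition single_rol (s : 'I_m) : rol m l :=
  exist _ (Bseq (l_gt0 : size [:: s] <= l)%N) isT.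

Lemma reveal_BNE_slotted (tau : behaviour n l V) :
  (forall (v : V) (s : 'I_m), u0 < val v 0 s) -> reveal_BNE q f u0 tau ->
  forall w, law f tau w != 0 -> forall i, slotted w i.
Proof.
move=> u0_lt tau_BNE w lw i; have [c] := ubnP (lottery w i).
elim: c w lw i => // c IHc w lw i; rewrite ltnS => lec.
set v := types w i; set k := lottery w i.
(* Student [i] averages over all plays compatible with [v] and [k], so the induction hypothesis is
   needed on all of them, not only on [w]. *)
have before w' : law f tau w' != 0 -> lottery w' i = k ->
    forall j, (lottery w' j < lottery w' i)%N -> slotted w' j.
  move=> lw' eqk j; rewrite eqk => ltj; apply: IHc => //.
  exact: leq_trans ltj lec.
apply: payoff_slot_slotted => //; first exact: before.
rewrite -/v -/k.
apply: (cond_Ex_ge_eq (Pr_knows_type_number_gt0 tau i v k)) => //;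
  [| |exact/andP].
- move=> w' /andP[/eqP eqv /eqP eqk] lw'.
  by rewrite -eqv -eqk; apply: payoff_le_slot; apply: before.
(* Listing the slot alone is a deviation that secures its value, so the equilibrium payoff is no
   smaller. *)
apply: le_trans (tau_BNE i v k (point_mass R (single_rol (slot k)))).
rewrite (cond_Ex_const (a := val v 0 (slot k))) ?Pr_knows_type_number_gt0 //.
move=> w' /andP[/eqP eqv /eqP eqk] lw'.
rewrite payoff_slotted ?eqv ?eqk //; apply: (slot_attained slot_card).
  (* The deviation leaves the outcomes of better numbers unchanged, by [da_ahead_only]. *)
  have [L [lL eqL]] := law_deviate lw'.
  move=> j ltj; have := before _ lL eqk j ltj; rewrite /slotted => <-.
  apply: da_ahead_only => j' lej'; apply/esym/eqL.
  by apply: contraL ltj => /eqP <-; rewrite -leqNgt.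
move/law_neq0P/(_ i): lw'; rewrite /deviate eqxx point_mass_neq0 => /eqP->.
by rewrite eqk.
Qed.

Definition slot_strategy (v : V) (k : 'I_n) : fdist R (rol m l) :=
  point_mass R (single_rol (slot k)).

Lemma single_rol_slotted w i :
  (forall j, (lottery w j <= lottery w i)%N ->
     lists w j = single_rol (slot (lottery w j))) ->
  slotted w i.
Proof.
have [c] := ubnP (lottery w i); elim: c i => // c IHc i; rewrite ltnS => lec single.
apply: (slot_attained slot_card) => [j ltj|]; last by rewrite -/(lists w) single.
apply: IHc => [|j' lej']; first exact: leq_trans ltj lec.
exact: single (leq_trans lej' (ltnW ltj)).
Qed.

Lemma slot_strategy_slotted w i :
  law f (fun _ => slot_strategy) w != 0 -> slotted w i.
Proof.
move/law_neq0P => lw; apply: single_rol_slotted => j _; apply/eqP.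
rewrite -(point_mass_neq0 R); exact: lw.
Qed.

(** Better numbers than the deviator's still list and get their slots, so [payoff_le_slot] caps
    every deviation at the value of his own slot. *)
Lemma slot_strategy_BNE : reveal_BNE q f u0 (fun _ => slot_strategy).
Proof.
move=> i v k p; rewrite [leRHS](cond_Ex_const (a := val v 0 (slot k))).
- apply: cond_Ex_le => [|w /andP[/eqP <- /eqP <-] /law_neq0P lw].
    exact: Pr_knows_type_number_gt0.
  apply: payoff_le_slot => j ltj; apply: single_rol_slotted => j' lej'.
  have /negPf neq : j' != i by apply: contraL ltj => /eqP <-; rewrite -leqNgt.
  apply/eqP; rewrite -(point_mass_neq0 R).
  by have := lw j'; rewrite /deviate neq.
- exact: Pr_knows_type_number_gt0.
move=> w /andP[/eqP <- /eqP <-] lw; rewrite payoff_slotted //.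
exact: slot_strategy_slotted.
Qed.

End Reveal.

End Probability.

(** * Waste, unmatched students and stochastic dominance in equilibrium *)

Theorem proposition2 (R : realFieldType) (n m l : nat)
    (l_gt0 : (0 < l)%N) (l_lt_m : (l < m)%N)
    (q : 'I_m -> nat) (q_gt0 : forall s, (0 < q s)%N)
    (sum_q : (\sum_(s : 'I_m) q s)%N = n)
    (V : {fset 'rV[R]_m})
    (V_unit : forall (v : V) (s : 'I_m), 0 <= val v 0 s <= 1)
    (V_decr : forall (v : V) (s t : 'I_m), (s < t)%N -> val v 0 t < val v 0 s)
    (f : fdist R V) (f_01 : forall v : V, 0 < f v < 1)
    (u0 : R) (u0_last : forall (v : V) (s : 'I_m), u0 <= val v 0 s)
    (sigma : V -> fdist R (rol m l))
    (sigma_BNE : symmetric_cover_BNE n q f u0 sigma) :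
  let b : behaviour n l V := uninformed (fun _ => sigma) in
  (* (1) *)
  0 < Pr f b (fun w => (m - l <= #|wasted_schools q w|)%N
                       && (wasted_capacity q w <= #|assigned q w None|)%N)
  (* (2) *)
  /\ (forall (i : 'I_n) (v : V),
        0 < cond_Pr f b (knows_type i v) (fun w => outcome q w i == None))
  (* (3) *)
  /\ [/\ forall (i j : 'I_n) (x : option 'I_m),
           random_assignment q f b i x = random_assignment q f b j x,
         forall i : 'I_n,
           fosd_by (random_assignment q f b i) (proportional_assignment R n q),
         exists tau : V -> 'I_n -> fdist R (rol m l),
           reveal_BNE q f u0 (fun _ => tau)
           /\ forall (i : 'I_n) (x : option 'I_m),
                random_assignment q f (fun _ => tau) i x
                = proportional_assignment R n q x
       & (forall (v : V) (s : 'I_m), u0 < val v 0 s) ->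
         forall tau : behaviour n l V, reveal_BNE q f u0 tau ->
         forall (i : 'I_n) (x : option 'I_m),
           random_assignment q f tau i x = proportional_assignment R n q x].
Proof.
move=> b; have f_gt0 v : 0 < f v by have /andP[] := f_01 v.
have [v0 _] := fdist_support f.
have monomorphic v : exists w : play n l V, exists L,
    [/\ law f b w != 0, types w = [ffun=> v] & lists w = [ffun=> L]].
  have [L sL] := fdist_support (sigma v).
  (* Everyone has type [v] and submits the same [L] from the support of [sigma v]; the identity
     lottery is an arbitrary choice. *)
  exists ([ffun=> v], [ffun=> L], 1%g); exists L; split=> //.
  by apply/law_neq0P => // i; rewrite /b /uninformed /types /lists /= !ffunE.
have wasted (w : play n l V) (L : rol m l) :
    lists w = [ffun=> L] -> (m - l <= #|wasted_schools q w|)%N.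
  by move=> listw; apply: (@wasted_monomorphic R n m l V q w L) => i; rewrite listw ffunE.
split.
  have [w [L [lw _ listw]]] := monomorphic v0.
  by apply: (Pr_gt0 _ lw) => //; rewrite (wasted w L) //= (wasted_capacityE sum_q).
split=> [i v|].
  have [w [L [lw typew listw]]] := monomorphic v.
  have [|j outj] := unmatched_exists (w := w) sum_q q_gt0.
    by apply: leq_trans (wasted w L listw); rewrite subn_gt0.
  (* The transposition puts [i] in the place of the unmatched [j]; as all types equal [v], the
     conditioning event still holds. *)
  set w' := relabel (tperm i j) w.
  have lw' : law f b w' != 0 by rewrite law_relabel.
  have knows : knows_type i v w' by rewrite /knows_type /types /= ffunE typew ffunE.
  apply: divr_gt0; last exact: (Pr_gt0 knows lw').
  apply: (Pr_gt0 _ lw'); rewrite /predI /= knows /=.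
  by rewrite outcome_relabel tpermL outj.
have [slot [slot_homo slot_card]] := slot_exists sum_q.
split.
- by move=> i j x; apply: random_assignment_symmetric.
(* The inequality holds school by school, hence for the partial sums. *)
- by move=> i k; apply: ler_sum => s _; apply: random_assignment_le.
- exists (slot_strategy slot l_gt0); split; first exact: slot_strategy_BNE.
  move=> i x; apply: (random_assignment_slotted slot_card) => // w.
  exact: slot_strategy_slotted.
move=> u0_lt tau tau_BNE i x.
apply: (random_assignment_slotted slot_card) => // w lw.
exact: (reveal_BNE_slotted f_gt0 slot_homo slot_card u0_last).
Qed.
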